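(* Let $T$ be a finite subset of $\mathbb{R}^n$, and let $S$ be a nonempty and proper subset of $T$. Then $V_T(S)\neq\emptyset$ if and only if there exists a closed Euclidean ball $B\supset S$ such that $\operatorname{int}B\cap(T\setminus S)=\emptyset$.
   Context: For a finite nonempty set $T\subset\mathbb{R}^n$ and a nonempty proper subset $S\subset T$, the multipoint (higher order) Voronoi cell is $$V_T(S):=\left\{x\in\mathbb{R}^n : \max_{s\in S}\|x-s\|\le\min_{t\in T\setminus S}\|x-t\|\right\},$$ where $\|\cdot\|$ is the Euclidean norm. $\operatorname{int}$ denotes the topological interior. *)

(* Defs.v *)
From HB Require Import structures.
From mathcomp Require Import all_boot all_order all_algebra finmap.
From mathcomp Require Import all_classical all_reals all_analysis.

Set Implicit Arguments.
Unset Strict Implicit.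
Unset Printing Implicit Defensive.

Import Order.TTheory GRing.Theory Num.Theory.
Import numFieldNormedType.Exports.

Local Open Scope classical_set_scope.
Local Open Scope ring_scope.

(* The norm `|x| of 'rV[R]_n is the sup norm, so the Euclidean norm has to be
   defined.  The two norms induce the same topology, hence the interior
   operator of 'rV[R]_n is the usual one of R^n. *)
Definition enorm (R : realType) (n : nat) (x : 'rV[R]_n) : R :=
  Num.sqrt (\sum_(i < n) x 0 i ^+ 2).

Definition eclosed_ball (R : realType) (n : nat) (c : 'rV[R]_n) (r : R) :
  set 'rV[R]_n := [set x | enorm (x - c) <= r].

Definition is_eclosed_ball (R : realType) (n : nat) (B : set 'rV[R]_n) : Prop :=
  exists c : 'rV[R]_n, exists2 r : R, 0 < r & B = eclosed_ball c r.

(* The maximum and minimum are taken in \bar R only to have a unit for the big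
   operator: for S nonempty and proper in T both are finite. *)
Definition voronoi_cell (R : realType) (n : nat) (T S : {fset 'rV[R]_n}) :
  set 'rV[R]_n :=
  [set x | (\big[maxe/-oo]_(s <- S) (enorm (x - s))%:E
            <= \big[mine/+oo]_(t <- (T `\` S)%fset) (enorm (x - t))%:E)%E].

(* Main.v *)
(* For [c] in the Voronoi cell, the ball centred at [c] whose radius is the
   distance from [c] to the nearest point of [T `\` S] works; conversely the
   centre of such a ball lies in the cell, because the points outside the
   interior of a ball are at distance at least its radius from the centre. *)
Require Import Defs.
From HB Require Import structures.
From mathcomp Require Import all_boot all_order all_algebra finmap.
From mathcomp Require Import all_classical all_reals all_analysis.

Set Implicit Arguments.
Unset Strict Implicit.
Unset Printing Implicit Defensive.

Import Order.TTheory GRing.Theory Num.Theory.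
Import numFieldNormedType.Exports.

Local Open Scope classical_set_scope.
Local Open Scope ring_scope.

Lemma enormN (R : realType) (n : nat) (x : 'rV[R]_n) : enorm (- x) = enorm x.
Proof. by rewrite /enorm; under eq_bigr => i _ do rewrite mxE sqrrN. Qed.

Lemma enorm_distC (R : realType) (n : nat) (x y : 'rV[R]_n) :
  enorm (x - y) = enorm (y - x).
Proof. by rewrite -enormN opprB. Qed.

Lemma enormZ (R : realType) (n : nat) (k : R) (x : 'rV[R]_n) :
  enorm (k *: x) = `|k| * enorm x.
Proof.
rewrite /enorm; under eq_bigr => i _ do rewrite mxE exprMn.
by rewrite -mulr_sumr sqrtrM ?sqr_ge0// sqrtr_sqr.
Qed.

Lemma enorm_gt0 (R : realType) (n : nat) (x : 'rV[R]_n) :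
  (0 < enorm x) = (x != 0).
Proof.
rewrite /enorm sqrtr_gt0 lt_def sumr_ge0 ?andbT; last by move=> *; exact: sqr_ge0.
congr (~~ _); rewrite psumr_eq0; last by move=> *; exact: sqr_ge0.
apply/allP/eqP => [x0|-> i _]; last by rewrite mxE expr0n eqxx.
apply/rowP => i; rewrite mxE; apply/eqP; rewrite -sqrf_eq0.
exact: x0 (mem_index_enum i).
Qed.

(** Continuity is meant for the sup-norm topology of ['rV[R]_n]; it makes strict Euclidean balls
    open there. *)
Lemma enorm_continuous (R : realType) (n : nat) :
  continuous (@enorm R n).
Proof.
move=> x; apply: (@continuous_comp _ _ _ _ Num.sqrt); last exact: sqrt_continuous.
apply: (continuous_big (@add_continuous R)) => i _ y.
apply: (@continuous_comp _ _ _ (fun z : 'rV[R]_n => z 0 i) (fun u : R => u ^+ 2)).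
  exact: coord_continuous.
exact: exprn_continuous.
Qed.

Lemma interior_eclosed_ball (R : realType) (n : nat) (c : 'rV[R]_n) (r : R) :
  0 < r -> interior (eclosed_ball c r) = [set x | enorm (x - c) < r].
Proof.
move=> r0; apply/seteqP; split => x /=; last first.
  move=> xr.
  have /cvgr_lt /(_ _ xr) : enorm (y - c) @[y --> x] --> enorm (x - c).
    have yc : y - c @[y --> x] --> x - c.
      by apply: (@cvgB _ _ _ _ (nbhs_filter x)); [exact: cvg_id|exact: cvg_cst].
    exact: (cvg_comp _ _ yc (@enorm_continuous R n _)).
  by apply: filterS => y /ltW.
move=> xB; rewrite ltNge; apply/negP => rx.
(* A point at distance at least [r] is pushed out of the ball by a homothety of
   centre [c] and ratio slightly larger than [1]. *)
have : c + k *: (x - c) @[k --> (1 : R)] --> c + 1 *: (x - c).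
  by apply: cvgD; [exact: cvg_cst|exact: scalel_continuous].
rewrite scale1r subrKC => /(_ _ xB) /nbhs_ex[d dB].
have d0 : 0 < d%:num / 2 by rewrite divr_gt0.
(* The ratio [1 + d / 2] is within [d] of [1], so the image of [x] still lies in the ball. *)
have := dB (1 + d%:num / 2).
rewrite /ball/= opprD addNKr normrN gtr0_norm//.
rewrite ltr_pdivrMr// ltr_pMr// ltr1n => /(_ isT).
rewrite /eclosed_ball/= addrAC subrr add0r enormZ gtr0_norm ?addr_gt0//.
(* As [0 < r], the point [x] differs from [c], so the homothety strictly increases its distance to
   [c]. *)
apply/negP; rewrite -ltNge (le_lt_trans rx)// ltr_pMl ?ltrDl//.
exact: lt_le_trans rx.
Qed.

(** This pairwise form eliminates extended reals. If [S] or its complement in [T] is empty, the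
    units [-oo] and [+oo] make the cell the whole space, matching the vacuous quantification. *)
Lemma voronoi_cellP (R : realType) (n : nat) (T S : {fset 'rV[R]_n})
    (x : 'rV[R]_n) :
  voronoi_cell T S x <->
  (forall s t, s \in S -> t \in (T `\` S)%fset -> enorm (x - s) <= enorm (x - t)).
Proof.
rewrite /voronoi_cell/=; split => [xV s t sS tT|xV].
  rewrite -lee_fin; apply: (le_trans _ (le_trans xV _)).
    exact: (le_bigmax_seq -oo%E _ xpredT (fun s => (enorm (x - s))%:E)).
  exact: (ge_bigmin_seq +oo%E _ xpredT (fun s => (enorm (x - s))%:E)).
rewrite big_seq; apply: bigmax_le => [|s sS]; first exact: leNye.
rewrite big_seq; apply: le_bigmin => [|t tT]; first exact: leey.
by rewrite lee_fin xV.
Qed.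

Theorem theorem2p2 (R : realType) (n : nat) (T S : {fset 'rV[R]_n})
    (S_neq0 : S != fset0) (S_proper : (S `<` T)%fset) :
  voronoi_cell T S !=set0 <->
  exists B : set 'rV[R]_n,
    [/\ is_eclosed_ball B,
        [set` S] `<=` B
      & interior B `&` [set` (T `\` S)%fset] = set0].
Proof.
split=> [[c /voronoi_cellP cV]|[_ [[c [r r0 ->]] SB BT]]]; last first.
  exists c; apply/voronoi_cellP => s t sS tT.
  rewrite enorm_distC [leRHS]enorm_distC; apply: le_trans (SB _ sS) _.
  rewrite leNgt; apply/negP => tr.
  suff : set0 t by [].
  by rewrite -BT interior_eclosed_ball.
have [t0 t0T] : exists t, t \in (T `\` S)%fset.
  by apply/fset0Pn; rewrite fsetD_eq0; case/andP: S_proper.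
have [s0 s0S] := fset0Pn _ S_neq0.
(* The default value is itself one of the distances, so [r] is the true minimum. *)
pose r := \big[Num.min/enorm (c - t0)]_(t <- (T `\` S)%fset) enorm (c - t).
(* [c] may be a point of [S], but it is not in [T `\` S]: it would then
   coincide with every point of [S]. *)
have dist_gt0 t : t \in (T `\` S)%fset -> 0 < enorm (c - t).
  move=> tT; rewrite enorm_gt0 subr_eq0; apply/eqP => ct.
  have /eqP s0c : c == s0.
    rewrite -subr_eq0 -[_ == _]negbK -enorm_gt0 -leNgt.
    apply: le_trans (cV _ _ s0S tT) _.
    by rewrite leNgt enorm_gt0 ct subrr eqxx.
  by move: tT; rewrite -ct s0c inE s0S.
have r0 : 0 < r.
  by rewrite /r big_seq; apply: lt_bigmin => [|t]; exact: dist_gt0.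
exists (eclosed_ball c r); split.
- by exists c, r.
- move=> s sS; rewrite /eclosed_ball/= enorm_distC /r big_seq.
  by apply: le_bigmin => [|t tT]; exact: cV.
(* A point of the interior is at distance less than [r] from [c], against the minimality of [r]. *)
- rewrite interior_eclosed_ball//; apply/seteqP; split => // t [/= + tT].
  rewrite enorm_distC ltNge => /negP; apply.
  exact: (ge_bigmin_seq _ _ xpredT (fun t => enorm (c - t))).
Qed.
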